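(* For every graph $H$ (with at least one vertex) and every positive integer $t$, the limit $\displaystyle\lim_{N\to\infty}\frac{\operatorname{cov}_{K_t}(N,H)}{N}$ exists.
   Context: All graphs are finite and simple. A graph $G$ is $H$-covered if every vertex of $G$ lies in a (not necessarily induced) subgraph of $G$ isomorphic to $H$. For $N\ge |V(H)|$, $\operatorname{cov}_{K_t}(N,H)$ denotes the minimum number of subgraphs isomorphic to $K_t$ among all $H$-covered graphs with $N$ vertices. *)

(* Defs.v *)
From mathcomp Require Import all_boot.
From mathcomp Require Import perm.

Set Implicit Arguments.
Unset Strict Implicit.
Unset Printing Implicit Defensive.

Definition sgraph (V : finType) :=
  {E : {set {set V}} | [forall e in E, #|e| == 2]}.

Definition edges (V : finType) (G : sgraph V) : {set {set V}} := val G.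

Lemma complete_subproof (V : finType) :
  [forall e in [set e : {set V} | #|e| == 2], #|e| == 2].
Proof. by apply/forall_inP => e; rewrite inE. Qed.

Definition complete (V : finType) : sgraph V :=
  exist _ [set e : {set V} | #|e| == 2] (complete_subproof V).

(* A pair (W, F) stands for a vertex set W together with an edge set F. *)
Definition is_subgraph (V : finType) (G : sgraph V)
    (S : {set V} * {set {set V}}) : bool :=
  (S.2 \subset edges G) && [forall e in S.2, e \subset S.1].

(* f is a bijection from the vertices of H onto S.1 that carries the edge set
   of H exactly onto S.2. *)
Definition iso_to (U V : finType) (H : sgraph U)
    (S : {set V} * {set {set V}}) : bool :=
  [exists f : {ffun U -> V},
    [&& injectiveb f,
        f @: [set: U] == S.1 &
        [set f @: (e : {set U}) | e in edges H] == S.2]].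

Definition copies (U V : finType) (H : sgraph U) (G : sgraph V) :
    {set {set V} * {set {set V}}} :=
  [set S | is_subgraph G S && iso_to H S].

Definition covered (U V : finType) (H : sgraph U) (G : sgraph V) : bool :=
  [forall v : V, exists S in copies H G, v \in S.1].

Definition nb_K (t : nat) (V : finType) (G : sgraph V) : nat :=
  #|copies (complete 'I_t) G|.

(* When U is nonempty and #|U| <= N the complete graph on N vertices is
   H-covered, so the minimum is over a nonempty set (see cov_min); otherwise
   the value is a default. *)
Definition cov (t N : nat) (U : finType) (H : sgraph U) : nat :=
  nb_K t [arg min_(G < complete 'I_N | covered H G) nb_K t G].

Lemma covered_complete (N : nat) (U : finType) (H : sgraph U) :
  0 < #|U| -> #|U| <= N -> covered H (complete 'I_N).
Proof.
move=> /card_gt0P[u _] UN; apply/forallP => v.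
pose f0 (x : U) : 'I_N := widen_ord UN (enum_rank x).
have f0I : injective f0.
  by move=> x y /(congr1 val) /= /val_inj; apply: enum_rank_inj.
pose f := [ffun x : U => tperm (f0 u) v (f0 x)].
have fI : injective f by move=> x y; rewrite !ffunE => /perm_inj /f0I.
pose S := (f @: [set: U], [set f @: (e : {set U}) | e in edges H]).
apply/exists_inP; exists S; last first.
  by apply/imsetP; exists u => //; rewrite ffunE tpermL.
rewrite inE; apply/andP; split; last first.
  by apply/existsP; exists f; rewrite !eqxx !andbT; apply/injectiveP.
apply/andP; split.
  apply/subsetP => _ /imsetP[e eH ->]; rewrite inE card_imset //.
  by move/forall_inP: (valP H); apply.
by apply/forall_inP => _ /imsetP[e _ ->]; apply/imsetS/subsetT.
Qed.

Lemma cov_min (t N : nat) (U : finType) (H : sgraph U) :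
  0 < #|U| -> #|U| <= N ->
  (exists2 G : sgraph 'I_N, covered H G & nb_K t G = cov t N H) /\
  (forall G : sgraph 'I_N, covered H G -> cov t N H <= nb_K t G).
Proof.
move=> U0 UN; rewrite /cov; case: arg_minnP; first exact: covered_complete.
by move=> G cG Gmin; split=> //; exists G.
Qed.

(* Main.v *)
(** If t > 0, then K_t is nonempty and connected, so each copy of K_t in a
    disjoint union lies in one of the two parts. As a disjoint union of
    H-covered graphs is H-covered, cov t (m + n) H <= cov t m H + cov t n H
    for m, n >= #|U|, and Fekete's lemma gives the limit. *)
Require Import Defs.
From mathcomp Require Import all_boot all_order all_algebra.
From mathcomp Require Import all_classical all_reals all_analysis.
From mathcomp Require Import lra.
Import numFieldNormedType.Exports.
Local Open Scope classical_set_scope.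
Local Open Scope ring_scope.

Import Order.TTheory GRing.Theory Num.Theory.

Section Push.
Local Open Scope nat_scope.
Local Open Scope set_scope.
Variables (U V W : finType) (f : V -> W).
Hypothesis f_inj : injective f.
Implicit Types (G : sgraph V) (K : sgraph W).

Definition push_subgraph (S : {set V} * {set {set V}}) :
    {set W} * {set {set W}} :=
  (f @: S.1, [set f @: (e : {set V}) | e in S.2]).

(** Composing the embedding of [H] with [f] keeps it injective. Applied to the two shifts, this
    transports coverage to a disjoint union. *)
Lemma copies_push (H : sgraph U) G K S :
  (forall e, e \in edges G -> (f @: e) \in edges K) ->
  S \in copies H G -> push_subgraph S \in copies H K.
Proof.
move=> GK; rewrite !inE => /andP[/andP[/fintype.subsetP SE /forall_inP SV]].
move=> /existsP[g /and3P[/injectiveP g_inj /eqP S1 /eqP S2]].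
apply/andP; split.
  apply/andP; split.
    by apply/fintype.subsetP => _ /imsetP[e eS ->]; apply/GK/SE.
  by apply/forall_inP => _ /imsetP[e eS ->]; apply/imsetS/SV.
apply/existsP; exists [ffun x => f (g x)]; apply/and3P; split.
- by apply/injectiveP => x y; rewrite !ffunE => /f_inj /g_inj.
- rewrite /= -S1 -imset_comp; apply/eqP/eq_imset => x.
  by rewrite ffunE.
- rewrite /= -S2 -imset_comp; apply/eqP/eq_imset => e /=.
  by rewrite -imset_comp; apply: eq_imset => x; rewrite ffunE.
Qed.

(* The hypothesis on edges says that the image of [f] is a union of connected
   components of [K]. *)
Lemma complete_copy_push (t : nat) G K S (x : V) :
  (forall e (y : V), e \in edges K -> f y \in e ->
     exists2 d, d \in edges G & e = (f @: d)) ->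
  S \in copies (complete 'I_t) K -> f x \in S.1 ->
  S \in (push_subgraph @: copies (complete 'I_t) G).
Proof.
move=> closedf; rewrite inE => /andP[/andP[/fintype.subsetP SE _]].
move=> /existsP[g /and3P[/injectiveP g_inj /eqP S1 /eqP S2]].
rewrite -S1 => /imsetP[i0 _ xi0].
have gE (e : {set 'I_t}) : #|e| == 2 -> (g @: e) \in edges K.
  by move=> e2; apply: SE; rewrite -S2; apply/imsetP; exists e; rewrite ?inE.
(* In a complete graph every [i] other than [i0] is adjacent to [i0], so [g i] shares an edge with
   [f x] and closedness puts it in the image of [f]. *)
have g_codom i : exists y, g i == f y.
  have [->|ne] := eqVneq i i0; first by exists x; rewrite xi0.
  have e2 : #|[set i0; i]| == 2 by rewrite cards2 (eq_sym i0) ne.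
  have [|d _ gd] := closedf _ x (gE _ e2).
    by rewrite xi0 imset_f // !inE eqxx.
  have : g i \in (g @: [set i0; i]) by rewrite imset_f // !inE eqxx orbT.
  by rewrite gd => /imsetP[y _ ->]; exists y.
pose k : {ffun 'I_t -> V} := [ffun i => xchoose (g_codom i)].
have gk i : g i = f (k i) by rewrite ffunE; apply/eqP/(xchooseP (g_codom i)).
have gk_im (e : {set 'I_t}) : (g @: e) = (f @: (k @: e)).
  by rewrite -imset_comp; apply: eq_imset => i; apply: gk.
apply/imsetP; exists (k @: [set: 'I_t],
  [set k @: (e : {set 'I_t}) | e in edges (complete 'I_t)]); last first.
  rewrite [S]surjective_pairing -S1 -S2 /push_subgraph /= gk_im.
  congr pair; rewrite -imset_comp; apply: eq_imset => e; exact: gk_im.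
rewrite inE; apply/andP; split; last first.
  apply/existsP; exists k; rewrite !eqxx !andbT; apply/injectiveP => i j kij.
  by apply: g_inj; rewrite !gk kij.
apply/andP; split; last first.
  by apply/forall_inP => _ /imsetP[e _ ->]; apply/imsetS/finset.subsetT.
apply/fintype.subsetP => _ /imsetP[e + ->]; rewrite inE => e2.
(* Closedness applies to an edge only once one of its vertices is known to be an image under [f];
   any [i] in [e] provides one. *)
have /card_gt0P[i ie] : 0 < #|e| by rewrite (eqP e2).
have [|d dG] := closedf _ (k i) (gE _ e2); first by rewrite -gk imset_f.
by rewrite gk_im => /(imset_inj f_inj) ->.
Qed.

End Push.

Section DisjointUnion.
Local Open Scope nat_scope.
Local Open Scope set_scope.
Variables (m n : nat) (G1 : sgraph 'I_m) (G2 : sgraph 'I_n).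

Let union_edges : {set {set 'I_(m + n)}} :=
  ([set (@lshift m n) @: (e : {set 'I_m}) | e in edges G1] :|:
   [set (@rshift m n) @: (e : {set 'I_n}) | e in edges G2]).

Lemma disjoint_union_subproof : [forall e in union_edges, #|e| == 2].
Proof.
apply/forall_inP => e; rewrite inE => /orP[] /imsetP[d dG ->].
- by rewrite card_imset; [exact: (forall_inP (valP G1)) | exact: lshift_inj].
- by rewrite card_imset; [exact: (forall_inP (valP G2)) | exact: rshift_inj].
Qed.

Definition disjoint_union : sgraph 'I_(m + n) :=
  exist _ union_edges disjoint_union_subproof.

Lemma covered_disjoint_union (U : finType) (H : sgraph U) :
  covered H G1 -> covered H G2 -> covered H disjoint_union.
Proof.
move=> /forallP c1 /forallP c2; apply/forallP => v.
case: (split_ordP v) => w ->.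
- have /exists_inP[S SH wS] := c1 w.
  apply/exists_inP; exists (push_subgraph _ _ (@lshift m n) S).
    apply: copies_push SH; first exact: lshift_inj.
    by move=> e eG; rewrite inE imset_f.
  by rewrite imset_f.
- have /exists_inP[S SH wS] := c2 w.
  apply/exists_inP; exists (push_subgraph _ _ (@rshift m n) S).
    apply: copies_push SH; first exact: rshift_inj.
    by move=> e eG; rewrite inE (imset_f _ eG) orbT.
  by rewrite imset_f.
Qed.

(** Each copy has a vertex since [t] is positive, and the side of that vertex shows which of the two
    graphs the copy is pushed from. *)
Lemma nb_K_disjoint_union (t : nat) :
  0 < t -> nb_K t disjoint_union <= nb_K t G1 + nb_K t G2.
Proof.
case: t => // t _.
apply: (@leq_trans #|(push_subgraph _ _ (@lshift m n) @:
    copies (complete 'I_t.+1) G1 :|: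
  push_subgraph _ _ (@rshift m n) @: copies (complete 'I_t.+1) G2)|); last first.
  by rewrite (leq_trans (leq_card_setU _ _)) // leq_add // leq_imset_card.
apply/subset_leq_card/fintype.subsetP => S SK; rewrite inE.
have [v vS] : exists v, v \in S.1.
  move: (SK); rewrite inE => /andP[_ /existsP[g /and3P[_ /eqP <- _]]].
  by exists (g ord0); rewrite imset_f.
case: (split_ordP v) vS => w -> wS; apply/orP; [left|right].
- apply: complete_copy_push SK wS; first exact: lshift_inj.
  move=> e y; rewrite inE => /orP[] /imsetP[d dG ->]; first by exists d.
  by move=> /imsetP[z _ /eqP]; rewrite eq_lrshift.
- apply: complete_copy_push SK wS; first exact: rshift_inj.
  move=> e y; rewrite inE => /orP[] /imsetP[d dG ->]; last by exists d.
  by move=> /imsetP[z _ /eqP]; rewrite eq_rlshift.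
Qed.

End DisjointUnion.

(** The disjoint union of two minimisers is a competitor in the minimum for [m + n]. *)
Lemma cov_subadditive (U : finType) (H : sgraph U) (t m n : nat) :
  (0 < #|U| -> 0 < t -> #|U| <= m -> #|U| <= n ->
  cov t (m + n) H <= cov t m H + cov t n H)%N.
Proof.
move=> U0 t0 Um Un.
have [[G1 c1 <-] _] := cov_min t H U0 Um.
have [[G2 c2 <-] _] := cov_min t H U0 Un.
have [_ min_cov] := cov_min t H U0 (leq_trans Um (leq_addr n m)).
apply: leq_trans (nb_K_disjoint_union _ _ G1 G2 _ t0).
exact/min_cov/covered_disjoint_union.
Qed.

(** Fekete's argument with subadditivity only from [h] on: the limit is the infimum of [u n / n]
    over [n >= h], and division with remainder by a nearly optimal [m] gives the upper bound. *)
Lemma fekete (R : realType) (u : R^nat) (h : nat) :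
  (0 < h)%N -> (forall n, 0 <= u n) ->
  (forall m n, (h <= m)%N -> (h <= n)%N -> u (m + n)%N <= u m + u n) ->
  exists l : R, (fun n => u n / n%:R) @ \oo --> l.
Proof.
move=> h0 u0 uD.
(* As [h > 0], this excludes [n = 0], whose quotient is 0 by convention and could falsify the
   infimum. *)
pose E := [set u n / n%:R | n in [set n | (h <= n)%N]].
have infE : has_inf E.
  split; first by exists (u h / h%:R); exists h => /=.
  by exists 0 => _ [n _ <-]; rewrite divr_ge0.
exists (inf E); apply/cvgrPdist_le => e e0.
have [|_ [m /= hm <-] um] := inf_adherent (_ : 0 < e / 2) infE.
  by rewrite divr_gt0.
have m0 : (0 < m)%N by exact: leq_trans hm.
(* By nonnegativity the sum serves as a crude maximum, bounding all remainders below [2m] at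
   once. *)
pose C := \sum_(r < m.*2) u r.
have uC r : (r < m.*2)%N -> u r <= C.
  by move=> rm; rewrite /C (bigD1 (Ordinal rm)) //= lerDl sumr_ge0.
have uq q r : (h <= r)%N -> u (q * m + r)%N <= q%:R * u m + u r.
  move=> hr; elim: q => [|q IHq]; first by rewrite mul0n add0n mul0r add0r.
  rewrite mulSn -addnA; apply: le_trans (uD _ _ hm _) _.
    by rewrite (leq_trans hr) // leq_addl.
  by rewrite -natr1 mulrDl mul1r; lra.
have u_le n : (m <= n)%N -> u n <= n%:R * (u m / m%:R) + C.
  move=> mn; have q0 : (0 < n %/ m)%N by rewrite divn_gt0.
  (* One block [m] is moved from the quotient to the remainder, which then lies in [[m, 2m)] and so
     is at least [h], as subadditivity requires. *)
  have nE : n = ((n %/ m).-1 * m + (m + n %% m))%N.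
    by rewrite addnA -mulSnr prednK // -divn_eq.
  have r_lt : (m + n %% m < m.*2)%N by rewrite -addnn ltn_add2l ltn_mod.
  rewrite {1}nE; apply: le_trans (uq _ _ (leq_trans hm (leq_addr _ _))) _.
  apply: lerD (uC _ r_lt).
  rewrite mulrCA mulrC ler_wpM2l // ler_pdivlMr ?ltr0n //.
  by rewrite -natrM ler_nat {2}nE leq_addr.
near=> n.
have mn : (m <= n)%N by near: n; exact: nbhs_infty_ge.
have n0 : (0 < n%:R :> R) by rewrite ltr0n (leq_trans m0).
(* This threshold makes [C / n] at most [e / 2]; the choice of [m] accounts for the other half of
   [e]. *)
have Cn : C / (e / 2) <= n%:R by near: n; exact: nbhs_infty_ger.
have lE : inf E <= u n / n%:R.
  by apply: ge_inf; [exact: infE.2 | exists n => //=; exact: leq_trans mn].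
have : u n / n%:R <= u m / m%:R + e / 2.
  rewrite ler_pdivrMr // (le_trans (u_le _ mn)) // mulrDl [n%:R * _]mulrC lerD2l.
  by rewrite mulrC -ler_pdivrMr // divr_gt0.
by rewrite distrC ger0_norm ?subr_ge0 //; move: um; lra.
Unshelve. all: by end_near. Qed.

Theorem corollary1p5 (R : realType) (U : finType) (H : sgraph U) (t : nat)
    (hU : (0 < #|U|)%N) (ht : (0 < t)%N) :
  exists l : R, (fun N : nat => (cov t N H)%:R / N%:R : R) @ \oo --> l.
Proof.
(* The threshold is [#|U|]: the default values that [cov] takes below it do not affect the limit. *)
apply: (fekete _ (fun N => (cov t N H)%:R) _ hU) => // m n Um Un.
by rewrite -natrD ler_nat cov_subadditive.
Qed.
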